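(* The linear span of the unique $\mathcal{M}_{\mathsf{BNC}}$-clique of arity $1$ together with all noncrossing $\mathcal{M}_{\mathsf{BNC}}$-cliques (of arity $\ge2$) without edges nor bases labeled by $\mathds{1}$ forms a suboperad of $\mathsf{NC}\mathcal{M}_{\mathsf{BNC}}$ isomorphic to $\mathsf{BNC}$. Moreover, the map $\phi$ defined in the context is an isomorphism between these two operads.
   Context: All vector spaces are over a field $\mathbb{K}$ of characteristic zero; $[n]=\{1,\dots,n\}$. Operad means nonsymmetric operad in vector spaces, graded by arities $n\ge1$. $\mathcal{M}_{\mathsf{BNC}}:=\{\mathds{1},\mathtt{a},\mathtt{b}\}$ is the (non-associative) unitary magma with unit $\mathds{1}$ and $\mathtt{a}\star\mathtt{a}=\mathtt{a}$, $\mathtt{b}\star\mathtt{b}=\mathtt{b}$, $\mathtt{a}\star\mathtt{b}=\mathtt{b}\star\mathtt{a}=\mathds{1}$. Write $\mathcal{M}=\mathcal{M}_{\mathsf{BNC}}$. An $\mathcal{M}$-clique $\mathfrak{p}$ of arity $n\ge1$ is a map assigning to every arc $(x,y)$, $1\le x<y\le n+1$, a label $\mathfrak{p}(x,y)\in\mathcal{M}$; by convention, the only $\mathcal{M}$-clique of arity $1$ is the one with $\mathfrak{p}(1,2)=\mathds{1}$. The base is $(1,n+1)$, with label $\mathfrak{p}_0$; for $n\ge2$ the $i$th edge is $(i,i+1)$, with label $\mathfrak{p}_i$, $i\in[n]$; the other arcs are diagonals (in arity $1$, put $\mathfrak{p}_1=\mathds{1}$). An arc is solid if its label is not $\mathds{1}$;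 diagonals $(x,y)$, $(x',y')$ are crossing if $x<x'<y<y'$ or $x'<x<y'<y$; an $\mathcal{M}$-clique is noncrossing if no two of its solid diagonals are crossing. $\mathsf{NC}\mathcal{M}$ is the operad spanned by the noncrossing $\mathcal{M}$-cliques, with unit the unique $\mathcal{M}$-clique of arity $1$, where, for $\mathfrak{p},\mathfrak{q}$ of arities $n,m$ and $i\in[n]$, $$(\mathfrak{p}\circ_i\mathfrak{q})(x,y)=\begin{cases}\mathfrak{p}(x,y)&\text{if }y\le i,\\ \mathfrak{p}(x,y-m+1)&\text{if }x\le i<i+m\le y,\ (x,y)\ne(i,i+m),\\ \mathfrak{p}(x-m+1,y-m+1)&\text{if }i+m\le x,\\ \mathfrak{q}(x-i+1,y-i+1)&\text{if }i\le x<y\le i+m,\ (x,y)\ne(i,i+m),\\ \mathfrak{p}_i\star\mathfrak{q}_0&\text{if }(x,y)=(i,i+m),\\ \mathds{1}&\text{otherwise.}\end{cases}$$ The operad $\mathsf{BNC}$ of bicolored noncrossing configurations: for $n\ge2$, $\mathsf{BNC}(n)$ is the linear span of all bicolored noncrossing configurations of arity $n$, i.e. regular polygons with vertices $1,\dots,n+1$ where each arc $(x,y)$, $1\le x<y\le n+1$, is blue, red or uncolored, such that no blue or red arc crosses another blue or red arc and all red arcs are diagonals. $\mathsf{BNC}(1)$ is spanned by the single polygon of arity $1$ whose only arc is uncolored, which is the unit. For $\mathfrak{c},\mathfrak{d}$ of arities $n,m\ge2$ and $i\in[n]$, $\mathfrak{c}\circ_i\mathfrak{d}$ is obtained by gluing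 the base of $\mathfrak{d}$ onto the $i$th edge of $\mathfrak{c}$ (arcs correspond as in the formula above, with all new arcs uncolored), and the arc $(i,i+m)$ becomes: red if both the base of $\mathfrak{d}$ and the $i$th edge of $\mathfrak{c}$ are uncolored; blue if both are blue; uncolored otherwise. $\phi:\mathsf{BNC}\to\mathsf{NC}\mathcal{M}_{\mathsf{BNC}}$ is the linear map sending the unit to the unit and a bicolored noncrossing configuration $\mathfrak{c}$ of arity $\ge2$ to the noncrossing $\mathcal{M}_{\mathsf{BNC}}$-clique obtained by labeling by $\mathtt{a}$ all blue arcs of $\mathfrak{c}$, by $\mathtt{b}$ all red diagonals, by $\mathtt{b}$ all uncolored edges and an uncolored base, and by $\mathds{1}$ all uncolored diagonals. *)

(* Defs.v *)
From HB Require Import structures.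
From mathcomp Require Import all_boot all_order all_algebra.
From mathcomp Require Import zify.
Set Implicit Arguments. Unset Strict Implicit. Unset Printing Implicit Defensive.
Import GRing.Theory.
Local Open Scope ring_scope.

(* Index convention: the component of index n of a graded family is the one of
   arity n.+1, so that arities start at 1 and partial compositions go from
   arities n.+1 and m.+1 to arity n.+1 + m.+1 - 1 = (n + m).+1.  Inputs, edges
   and vertices are numbered from 0: input i : 'I_n.+1 is the (i+1)-st one. *)

Definition cast_ar (T : nat -> Type) m n (e : m = n) (x : T m) : T n :=
  eq_rect m T x n e.

(* op_seq  : x o_i (y o_j z) = (x o_i y) o_(i+j) z
   op_par  : (x o_i y) o_(j+m) z = (x o_j z) o_i y for i < j, where y has m.+1
             inputs.
   All the uses of inord below are in bounds. *)
Record operad (K : fieldType) := Operad {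
  op_car :> nat -> lmodType K;
  op_unit : op_car 0;
  op_comp : forall n m, 'I_n.+1 -> op_car n -> op_car m -> op_car (n + m);
  op_linearl : forall n m (i : 'I_n.+1) (y : op_car m),
    linear (fun x : op_car n => op_comp i x y);
  op_linearr : forall n m (i : 'I_n.+1) (x : op_car n),
    linear (fun y : op_car m => op_comp i x y);
  op_unitl : forall n (x : op_car n), op_comp ord0 op_unit x = x;
  op_unitr : forall n (i : 'I_n.+1) (x : op_car n),
    cast_ar (T := op_car) (addn0 n) (op_comp i x op_unit) = x;
  op_seq : forall n m k (i : 'I_n.+1) (j : 'I_m.+1)
      (x : op_car n) (y : op_car m) (z : op_car k),
    op_comp i x (op_comp j y z) =
    cast_ar (T := op_car) (esym (addnA n m k)) (op_comp (inord (i + j)) (op_comp i x y) z);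
  op_par : forall n m k (i j : 'I_n.+1)
      (x : op_car n) (y : op_car m) (z : op_car k), (i < j)%N ->
    op_comp (inord (j + m)) (op_comp i x y) z =
    cast_ar (T := op_car) (addnAC n k m) (op_comp (inord i) (op_comp j x z) y)
}.

Record suboperad (K : fieldType) (P : operad K) := Suboperad {
  so_space :> forall n, submodClosed (P n);
  so_unit : op_unit P \in so_space 0;
  so_comp : forall n m (i : 'I_n.+1) (x : P n) (y : P m),
    x \in so_space n -> y \in so_space m -> op_comp i x y \in so_space (n + m)
}.

Section Subspace.
Variables (K : fieldType) (V : lmodType K) (S : submodClosed V).
Definition subspace_pred : {pred V} := S.
HB.instance Definition _ :=
  GRing.isSubmodClosed.Build K V subspace_pred (GRing.submodClosedP S).
Inductive subspace : predArgType := Subspace x of x \in subspace_pred.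
Definition subspace_val (u : subspace) : V := let: Subspace x _ := u in x.
HB.instance Definition _ := [isSub of subspace for subspace_val].
HB.instance Definition _ := [Choice of subspace by <:].
HB.instance Definition _ := [SubChoice_isSubZmodule of subspace by <:].
HB.instance Definition _ := [SubZmodule_isSubLmodule of subspace by <:].
End Subspace.

Section SubOperad.
Variables (K : fieldType) (P : operad K) (S : suboperad P).

Definition sub_unit : subspace (S 0) := Sub (op_unit P) (so_unit S).
Definition sub_comp n m (i : 'I_n.+1) (x : subspace (S n)) (y : subspace (S m)) :
  subspace (S (n + m)) := Sub (op_comp i (val x) (val y)) (so_comp i (valP x) (valP y)).

Lemma val_cast_ar m n (e : m = n) (x : subspace (S m)) :
  val (cast_ar (T := fun n => subspace (S n)) e x) = cast_ar (T := op_car P) e (val x).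
Proof. by case: n / e. Qed.

Definition operad_of_suboperad : operad K.
Proof.
refine (@Operad K (fun n => subspace (S n)) sub_unit sub_comp _ _ _ _ _ _).
- by move=> n m i y a x x'; apply/val_inj; rewrite /= op_linearl.
- by move=> n m i y a x x'; apply/val_inj; rewrite /= op_linearr.
- by move=> n x; apply/val_inj; rewrite /= op_unitl.
- by move=> n i x; apply/val_inj; rewrite val_cast_ar /= op_unitr.
- by move=> n m k i j x y z; apply/val_inj; rewrite val_cast_ar /= op_seq.
- by move=> n m k i j x y z ij; apply/val_inj; rewrite val_cast_ar /= op_par.
Defined.
End SubOperad.

Record is_operad_iso (K : fieldType) (P Q : operad K) (f : forall n, P n -> Q n) : Prop :=
  IsOperadIso {
  iso_linear : forall n, linear (f n);
  iso_bij : forall n, bijective (f n);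
  iso_unit : f 0%N (op_unit P) = op_unit Q;
  iso_comp : forall n m (i : 'I_n.+1) (x : P n) (y : P m),
    f (n + m)%N (op_comp i x y) = op_comp i (f n x) (f m y)
}.

Definition isomorphic (K : fieldType) (P Q : operad K) : Prop :=
  exists f : forall n, P n -> Q n, is_operad_iso f.

(* The same axioms in the category of finite sets; both operads of interest have
   a basis stable under the partial compositions. *)
Record set_operad := SetOperad {
  set_car :> nat -> finType;
  set_unit : set_car 0;
  set_comp : forall n m, 'I_n.+1 -> set_car n -> set_car m -> set_car (n + m);
  set_unitl : forall n (x : set_car n), set_comp ord0 set_unit x = x;
  set_unitr : forall n (i : 'I_n.+1) (x : set_car n),
    cast_ar (T := set_car) (addn0 n) (set_comp i x set_unit) = x;
  set_seq : forall n m k (i : 'I_n.+1) (j : 'I_m.+1)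
      (x : set_car n) (y : set_car m) (z : set_car k),
    set_comp i x (set_comp j y z) =
    cast_ar (T := set_car) (esym (addnA n m k))
      (set_comp (inord (i + j)) (set_comp i x y) z);
  set_par : forall n m k (i j : 'I_n.+1)
      (x : set_car n) (y : set_car m) (z : set_car k), (i < j)%N ->
    set_comp (inord (j + m)) (set_comp i x y) z =
    cast_ar (T := set_car) (addnAC n k m)
      (set_comp (inord i) (set_comp j x z) y)
}.

Section Free.
Variable K : fieldType.

Definition freemod (T : finType) := {ffun T -> K^o}.
HB.instance Definition _ T := Vector.on (freemod T).

Definition basis_elt (T : finType) (t : T) : freemod T := [ffun u => (u == t)%:R].

Definition free_map (T U : finType) (h : T -> U) (f : freemod T) : freemod U :=
  \sum_t f t *: basis_elt (h t).

Lemma free_decomp (T : finType) (f : freemod T) : f = \sum_t f t *: basis_elt t.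
Proof.
apply/ffunP=> u; rewrite sum_ffunE (bigD1 u) //= !ffunE eqxx.
rewrite big1 ?addr0 => [|t tu]; last by rewrite !ffunE eq_sym (negPf tu) scaler0.
by rewrite /GRing.scale /= mulr1.
Qed.

Lemma free_ext (T : finType) (V : lmodType K) (f g : freemod T -> V) :
  linear f -> linear g -> (forall t, f (basis_elt t) = g (basis_elt t)) -> f =1 g.
Proof.
move=> lf lg fg x; rewrite (free_decomp x).
pose F := HB.pack_for {linear freemod T -> V} f (GRing.isLinear.Build K _ _ _ f lf).
pose G := HB.pack_for {linear freemod T -> V} g (GRing.isLinear.Build K _ _ _ g lg).
rewrite -[LHS]/(F _) -[RHS]/(G _) !linear_sum; apply: eq_bigr => t _.
by rewrite !linearZ /= fg.
Qed.

Section Linearization.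
Variable S : set_operad.

Definition lin_comp n m (i : 'I_n.+1) (f : freemod (S n)) (g : freemod (S m)) :
    freemod (S (n + m)%N) :=
  \sum_x \sum_y (f x * g y) *: basis_elt (set_comp i x y).

Lemma lin_compl n m (i : 'I_n.+1) (g : freemod (S m)) :
  linear (fun f : freemod (S n) => lin_comp i f g).
Proof.
move=> a f f'; rewrite scaler_sumr -big_split; apply: eq_bigr => x _ /=.
rewrite scaler_sumr -big_split; apply: eq_bigr => y _ /=.
by rewrite !ffunE mulrDl scalerDl scalerA mulrA.
Qed.

Lemma lin_compr n m (i : 'I_n.+1) (f : freemod (S n)) :
  linear (fun g : freemod (S m) => lin_comp i f g).
Proof.
move=> a g g'; rewrite scaler_sumr -big_split; apply: eq_bigr => x _ /=.
rewrite scaler_sumr -big_split; apply: eq_bigr => y _ /=.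
by rewrite !ffunE mulrDr scalerDl scalerA mulrCA.
Qed.

Lemma lin_comp_basis n m (i : 'I_n.+1) (x : S n) (y : S m) :
  lin_comp i (basis_elt x) (basis_elt y) = basis_elt (set_comp i x y).
Proof.
rewrite /lin_comp (bigD1 x) //= (bigD1 y) //= !ffunE !eqxx mulr1 scale1r.
rewrite !big1 ?addr0 // => [x' xx'|y' yy'].
  by rewrite big1 // => y' _; rewrite !ffunE (negPf xx') mul0r scale0r.
by rewrite !ffunE (negPf yy') mulr0 scale0r.
Qed.

Lemma cast_linear m n (e : m = n) (V : lmodType K) (f : V -> freemod (S m)) :
  linear f -> linear (fun x => cast_ar (T := fun n => freemod (S n)) e (f x)).
Proof. by case: n / e. Qed.

Lemma cast_basis m n (e : m = n) (x : S m) :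
  cast_ar (T := fun n => freemod (S n)) e (basis_elt x)
  = basis_elt (cast_ar (T := set_car S) e x).
Proof. by case: n / e. Qed.

Lemma linear_comp (U V W : lmodType K) (f : U -> V) (g : V -> W) :
  linear f -> linear g -> linear (fun x => g (f x)).
Proof. by move=> lf lg a x y; rewrite lf lg. Qed.

Definition linearization : operad K.
Proof.
refine (@Operad K (fun n => freemod (S n)) (basis_elt (set_unit S)) lin_comp
  lin_compl lin_compr _ _ _ _).
- move=> n; apply: (@free_ext _ (freemod (S n))) => [||x]; [exact: (@lin_compr 0 n ord0) | by [] |].
  by rewrite lin_comp_basis set_unitl.
- move=> n i; apply: (@free_ext _ (freemod (S n))) => [||x].
  + by apply: cast_linear; apply: lin_compl.
  + by [].
  + by rewrite lin_comp_basis cast_basis set_unitr.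
- move=> n m k i j x y z; move: x.
  apply: (@free_ext _ (freemod (S (n + (m + k))%N))) => [||x].
  + exact: lin_compl.
  + apply: cast_linear.
    exact: (linear_comp (lin_compl i y) (lin_compl (inord (i + j)) z)).
  move: y; apply: (@free_ext _ (freemod (S (n + (m + k))%N))) => [||y].
  + exact: (linear_comp (lin_compl j z) (lin_compr i (basis_elt x))).
  + apply: cast_linear.
    exact: (linear_comp (lin_compr i (basis_elt x)) (lin_compl (inord (i + j)) z)).
  move: z; apply: (@free_ext _ (freemod (S (n + (m + k))%N))) => [||z].
  + exact: (linear_comp (lin_compr j (basis_elt y)) (lin_compr i (basis_elt x))).
  + by apply: cast_linear; exact: lin_compr.
  by rewrite !lin_comp_basis cast_basis set_seq.
- move=> n m k i j x y z ij; move: x.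
  apply: (@free_ext _ (freemod (S (n + m + k)%N))) => [||x].
  + exact: (linear_comp (lin_compl i y) (lin_compl (inord (j + m)) z)).
  + apply: cast_linear.
    exact: (linear_comp (lin_compl j z) (lin_compl (inord i) y)).
  move: y; apply: (@free_ext _ (freemod (S (n + m + k)%N))) => [||y].
  + exact: (linear_comp (lin_compr i (basis_elt x)) (lin_compl (inord (j + m)) z)).
  + by apply: cast_linear; exact: lin_compr.
  move: z; apply: (@free_ext _ (freemod (S (n + m + k)%N))) => [||z].
  + exact: lin_compr.
  + apply: cast_linear.
    exact: (linear_comp (lin_compr j (basis_elt x)) (lin_compl (inord i) (basis_elt y))).
  by rewrite !lin_comp_basis cast_basis set_par.
Defined.
End Linearization.
End Free.

Local Open Scope nat_scope.

(* Arc (x, y) of a polygon of arity n, whose vertices are 0, ..., n and whose base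
   is (0, n); it is only meant for x < y <= n. *)
Definition diagonal (n x y : nat) : bool := (y != x.+1) && ((x, y) != (0, n)).

Definition crossing (x y x' y' : nat) : bool :=
  [&& x < x', x' < y & y < y'] || [&& x' < x, x < y' & y' < y].

Section Glue.
Variable L : eqType.

(* Labels of the polygon obtained by gluing the base of q, of arity m, onto the
   edge (i, i.+1) of p; w is the label of the resulting arc (i, i + m), and z the
   label of the new arcs. *)
Definition glue (z w : L) (i m : nat) (p q : nat -> nat -> L) (x y : nat) : L :=
  if y <= i then p x y
  else if (x, y) == (i, i + m) then w
  else if (x <= i) && (i + m <= y) then p x (y.+1 - m)
  else if i + m <= x then p (x.+1 - m) (y.+1 - m)
  else if (i <= x) && (y <= i + m) then q (x - i) (y - i)
  else z.

Variables (z : L) (mrg : nat -> nat -> L -> L -> L).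
Hypothesis mrg1l : forall m v, 0 < m -> mrg 1 m z v = v.
Hypothesis mrg1r : forall n v, 0 < n -> (n = 1 -> v = z) -> mrg n 1 v z = v.
Hypothesis mrgE : forall n n' m m', 1 < n -> 1 < n' -> 1 < m -> 1 < m' -> mrg n m = mrg n' m'.

Definition gl n m i p q := glue z (mrg n m (p i i.+1) (q 0 m)) i m p q.

Variant glue_spec (w : L) (i m : nat) (p q : nat -> nat -> L) (x y : nat) : L -> Prop :=
| GlueL of y <= i : glue_spec w i m p q x y (p x y)
| GlueM of x = i & y = i + m : glue_spec w i m p q x y w
| GlueO of x <= i & i + m <= y & x < i \/ i + m < y :
    glue_spec w i m p q x y (p x (y.+1 - m))
| GlueR of i + m <= x : glue_spec w i m p q x y (p (x.+1 - m) (y.+1 - m))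
| GlueI of i <= x & y <= i + m & i < x \/ y < i + m :
    glue_spec w i m p q x y (q (x - i) (y - i))
| GlueZ of x < i /\ i < y < i + m \/ i < x < i + m /\ i + m < y :
    glue_spec w i m p q x y z.

Lemma glueP w i m p q x y : x < y -> 0 < m ->
  glue_spec w i m p q x y (glue z w i m p q x y).
Proof.
move=> xy m0; rewrite /glue xpair_eqE.
case: leqP => h1; first exact: GlueL.
case: andP => [[/eqP h2 /eqP h3]|h2]; first exact: GlueM.
case: andP => [[h3 h4]|h3]; first by apply: GlueO => //; lia.
case: leqP => h4; first exact: GlueR.
case: andP => [[h5 h6]|h5]; first by apply: GlueI => //; lia.
by apply: GlueZ; lia.
Qed.

Lemma glue_ext w w' i n m p p' q q' :
  i < n -> 0 < m -> w = w' ->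
  (forall x y, x < y <= n -> p x y = p' x y) ->
  (forall x y, x < y <= m -> q x y = q' x y) ->
  forall x y, x < y < n + m -> glue z w i m p q x y = glue z w' i m p' q' x y.
Proof.
move=> ltin m0 -> pp qq x y xy; rewrite /glue xpair_eqE.
repeat (case: ifP => ?) => //; try (apply: pp; lia); try (apply: qq; lia).
Qed.

Let mrg_arity n n' m m' v w : 0 < n -> 0 < n' -> 0 < m -> 0 < m' ->
  (n == 1) = (n' == 1) -> (m == 1) = (m' == 1) ->
  (n = 1 -> v = z) -> (m = 1 -> w = z) -> mrg n m v w = mrg n' m' v w.
Proof.
move=> n0 n'0 m0 m'0 en em vz wz.
have [n1|n1] := eqVneq n 1.
  have -> : n' = 1 by lia.
  by rewrite n1 vz // !mrg1l.
have [m1|m1] := eqVneq m 1.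
  have -> : m' = 1 by lia.
  rewrite m1 wz // !mrg1r // => n'1; apply: vz; lia.
by rewrite (@mrgE n n' m m') //; lia.
Qed.

Ltac spl := case: glueP; try lia; intros; try lia; try reflexivity; try by f_equal; lia.

Lemma gl_seq n m k i j p q r x y : i < n -> j < m -> 0 < k ->
  (n = 1 -> p 0 1 = z) -> (m = 1 -> q 0 1 = z) -> (k = 1 -> r 0 1 = z) ->
  x < y <= (n + m + k).-2 ->
  gl n (m + k).-1 i p (gl m k j q r) x y =
  gl (n + m).-1 k (i + j) (gl n m i p q) r x y.
Proof.
move=> ltin ltjm k0 p1 q1 r1 xy; rewrite /gl.
have pi : n = 1 -> p i i.+1 = z by move=> n1; rewrite -p1 //; f_equal; lia.
have qj : m = 1 -> q j j.+1 = z by move=> m1; rewrite -q1 //; f_equal; lia.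
repeat spl.
- have m1 : m = 1 by lia.
  rewrite qj // m1 (mrg1l _ k0) q1 // mrg1r //; last lia.
  by congr (mrg _ _ _ _); lia.
- have -> : (m + k).-1.+1 - k = m by lia.
  by apply: (@mrg_arity n n (m + k).-1 m) => //; try lia; move=> ?; exfalso; lia.
- have -> : (i + j).+1 - i = j.+1 by lia.
  have -> : i + j - i = j by lia.
  have [k1|k1] := eqVneq k 1; first by rewrite k1 r1 // !mrg1r //; lia.
  by rewrite (@mrgE m (n + m).-1 k k) //; lia.
Qed.

Lemma gl_par n m k i j p q r x y : i < j < n -> 0 < m -> 0 < k ->
  (n = 1 -> p 0 1 = z) -> (m = 1 -> q 0 1 = z) -> (k = 1 -> r 0 1 = z) ->
  x < y <= (n + m + k).-2 ->
  gl (n + m).-1 k (j + m.-1) (gl n m i p q) r x y =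
  gl (n + k).-1 m i (gl n k j p r) q x y.
Proof.
move=> ltij m0 k0 p1 q1 r1 xy; rewrite /gl.
repeat spl.
- by apply: mrg_arity => //; try lia; move=> m1; first [exfalso; lia | rewrite {1}m1 q1].
- have -> : (j + m.-1).+1 - m = j by lia.
  have -> : (j + m.-1).+2 - m = j.+1 by lia.
  by apply: mrg_arity => //; try lia; move=> k1; first [exfalso; lia | rewrite {1}k1 r1].
Qed.

Lemma gl_unitl m q x y : 0 < m -> x < y <= m ->
  gl 1 m 0 (fun _ _ => z) q x y = q x y.
Proof.
move=> m0 xy; rewrite /gl mrg1l //.
by spl.
Qed.

Lemma gl_unitr n i p x y : i < n -> (n = 1 -> p 0 1 = z) -> x < y <= n ->
  gl n 1 i p (fun _ _ => z) x y = p x y.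
Proof.
move=> ltin p1 xy; rewrite /gl mrg1r; first by spl.
  by lia.
by move=> n1; rewrite -p1 //; f_equal; lia.
Qed.

Definition ncr n (p : nat -> nat -> L) := forall x y x' y',
  x < x' < y -> y < y' <= n -> p x y != z -> p x' y' != z -> False.

Lemma gl_ncr n m i p q : i < n -> 0 < m -> ncr n p -> ncr m q ->
  ncr (n + m).-1 (gl n m i p q).
Proof.
move=> ltin m0 np nq x y x' y' h h'; rewrite /gl.
set w := mrg _ _ _ _.
have g1 : glue_spec w i m p q x y (glue z w i m p q x y) by apply: glueP; lia.
have g2 : glue_spec w i m p q x' y' (glue z w i m p q x' y') by apply: glueP; lia.
move: (glue z w i m p q x y) (glue z w i m p q x' y') g1 g2 => A B g1 g2 H1 H2.
destruct g1; try lia; destruct g2; try lia;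
match goal with
| H : is_true (z != z) |- _ => by rewrite eqxx in H
| H1 : is_true (p ?a ?b != z), H2 : is_true (p ?c ?d != z) |- _ =>
  first [lia | by apply: (np a b c d) => //; lia | by apply: (np c d a b) => //; lia]
| H1 : is_true (q ?a ?b != z), H2 : is_true (q ?c ?d != z) |- _ =>
  first [lia | by apply: (nq a b c d) => //; lia | by apply: (nq c d a b) => //; lia]
| _ => idtac end; try lia.
Qed.

Variable c0 : L.
Hypothesis mrg_c0 : forall n m v w, 0 < n -> 0 < m -> mrg n m v w = c0 ->
  [\/ n = 1 /\ w = c0, m = 1 /\ v = c0 | 1 < n /\ 1 < m].

Definition dgr n (p : nat -> nat -> L) := forall x y,
  x < y <= n -> p x y = c0 -> diagonal n x y.

Lemma gl_dgr n m i p q : i < n -> 0 < m -> dgr n p -> dgr m q ->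
  dgr (n + m).-1 (gl n m i p q).
Proof.
move=> ltin m0 dp dq x y xy; rewrite /gl.
have ltin0 : 0 < n by lia.
case: (glueP (mrg n m (p i i.+1) (q 0 m)) i p q); try lia; intros;
repeat match goal with
 | H : mrg _ _ _ _ = c0 |- _ => have := mrg_c0 ltin0 m0 H; clear H => -[[]|[]|[]]; intros
 | H : p ?a ?b = c0 |- _ => have := dp a b _ H; clear H
 | H : q ?a ?b = c0 |- _ => have := dq a b _ H; clear H
 end; rewrite /diagonal ?xpair_eqE; lia.
Qed.

End Glue.

Section Polygon.
Variables (L : finType) (z : L).

Definition arc n := {a : 'I_n.+1 * 'I_n.+1 | a.1 < a.2}.
Definition src n (a : arc n) : nat := (val a).1.
Definition tgt n (a : arc n) : nat := (val a).2.

Definition polygon n := {ffun arc n -> L}.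

(* Label as a function of two natural numbers, meaningful for x < y <= n. *)
Definition label n (p : polygon n) (x y : nat) : L :=
  oapp p z (insub (inord x, inord y)).

Definition blank n : polygon n := [ffun=> z].

(* mrg n m v w is the label of the glued arc when the polygons have arities n and
   m, v is the label of the edge of the first one and w that of the base of the
   second one. *)
Variable mrg : nat -> nat -> L -> L -> L.

Definition compose n m (i : nat) (p : polygon n.+1) (q : polygon m.+1) :
    polygon (n + m).+1 :=
  let w := mrg n.+1 m.+1 (label p i i.+1) (label q 0 m.+1) in
  [ffun a => glue z w i m.+1 (label p) (label q) (src a) (tgt a)].

Lemma label_arc n (p : polygon n) (a : arc n) : label p (src a) (tgt a) = p a.
Proof.
rewrite /label /src /tgt !inord_val.
by rewrite -surjective_pairing valK.
Qed.

Lemma arc_exists n x y : x < y <= n -> exists a : arc n, src a = x /\ tgt a = y.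
Proof.
move=> xy.
have xn : x < n.+1 by lia.
have yn : y < n.+1 by lia.
have h : (Ordinal xn, Ordinal yn).1 < (Ordinal xn, Ordinal yn).2 by rewrite /=; lia.
by exists (Sub (Ordinal xn, Ordinal yn) h).
Qed.

Lemma arc_bound n (a : arc n) : src a < tgt a <= n.
Proof. by case: a => [[x y] /= h]; rewrite /src /tgt /= h -ltnS ltn_ord. Qed.

Lemma polygonP n (p q : polygon n) :
  (forall x y, x < y <= n -> label p x y = label q x y) <-> p = q.
Proof.
split=> [h|->//]; apply/ffunP => a.
by rewrite -!label_arc; apply: h; apply: arc_bound.
Qed.

Lemma label_blank n x y : label (blank n) x y = z.
Proof. by rewrite /label; case: insubP => //= a _ _; rewrite ffunE. Qed.

Lemma label_compose n m i (p : polygon n.+1) (q : polygon m.+1) x y :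
  x < y <= (n + m).+1 ->
  label (compose i p q) x y = gl z mrg n.+1 m.+1 i (label p) (label q) x y.
Proof. by case/arc_exists=> a [<- <-]; rewrite label_arc ffunE. Qed.

Hypothesis mrg1l : forall m v, 0 < m -> mrg 1 m z v = v.
Hypothesis mrg1r : forall n v, 0 < n -> (n = 1 -> v = z) -> mrg n 1 v z = v.
Hypothesis mrgE : forall n n' m m',
  1 < n -> 1 < n' -> 1 < m -> 1 < m' -> mrg n m = mrg n' m'.
Variable ok : forall n, pred (polygon n).
Hypothesis ok1 : forall p : polygon 1, ok p -> label p 0 1 = z.
Hypothesis ok_blank : ok (blank 1).
Hypothesis ok_compose : forall n m (i : 'I_n.+1) (p : polygon n.+1) (q : polygon m.+1),
  ok p -> ok q -> ok (compose i p q).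

Definition ok_polygon n := {p : polygon n.+1 | ok p}.

Definition ok_unit : ok_polygon 0 := Sub (blank 1) ok_blank.
Definition ok_comp n m (i : 'I_n.+1) (p : ok_polygon n) (q : ok_polygon m) :
  ok_polygon (n + m) := Sub (compose i (val p) (val q)) (ok_compose i (valP p) (valP q)).

Lemma label_cast m n (e : m = n) (p : ok_polygon m) :
  label (val (cast_ar (T := ok_polygon) e p)) =2 label (val p).
Proof. by case: n / e. Qed.

Lemma label1 n (p : ok_polygon n) : n.+1 = 1 -> label (val p) 0 1 = z.
Proof. by case=> n0; subst n; apply: ok1 (valP p). Qed.

Lemma gl_ext n m i p p' q q' x y : i < n -> 0 < m ->
  (forall x y, x < y <= n -> p x y = p' x y) ->
  (forall x y, x < y <= m -> q x y = q' x y) ->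
  x < y < n + m -> gl z mrg n m i p q x y = gl z mrg n m i p' q' x y.
Proof.
move=> ltin m0 pp qq xy; apply: (@glue_ext _ _ _ _ i n) => //.
by rewrite pp ?qq //; lia.
Qed.

Definition polygon_operad : set_operad.
Proof.
refine (@SetOperad ok_polygon ok_unit ok_comp _ _ _ _).
- move=> n p; apply/val_inj/polygonP => x y xy.
  rewrite label_compose // -[RHS](gl_unitl (z := z) (mrg := mrg) mrg1l (m := n.+1)) //.
  apply: gl_ext => //= *; rewrite ?label_blank //; lia.
- move=> n i p; apply/val_inj/polygonP => x y xy.
  rewrite label_cast label_compose /=; last lia.
  rewrite -[RHS](gl_unitr (z := z) (mrg := mrg) mrg1r (n := n.+1) (i := i)) //;
    last exact: label1.
  apply: gl_ext => //= *; rewrite ?label_blank //; lia.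
- move=> n m k i j p q r; apply/val_inj/polygonP => x y xy.
  rewrite label_cast !label_compose /=; try lia.
  have ij : i + j < (n + m).+1 by have := ltn_ord i; have := ltn_ord j; lia.
  rewrite inordK //.
  transitivity (gl z mrg n.+1 (m + k).+1 i (label (val p))
    (gl z mrg m.+1 k.+1 j (label (val q)) (label (val r))) x y).
    by apply: gl_ext => //= [x' y' h|]; [rewrite label_compose //|]; lia.
  transitivity (gl z mrg (n + m).+1 k.+1 (i + j)
    (gl z mrg n.+1 m.+1 i (label (val p)) (label (val q))) (label (val r)) x y); last first.
    by apply: gl_ext => //= [x' y' h|]; [rewrite label_compose //|]; lia.
  have := @gl_seq _ z mrg mrg1l mrg1r mrgE n.+1 m.+1 k.+1 i j (label (val p))
    (label (val q)) (label (val r)) x y.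
  rewrite !addnS !addSn /=; apply => //; try exact: label1; lia.
- move=> n m k i j p q r ij; apply/val_inj/polygonP => x y xy.
  rewrite label_cast !label_compose /=; try lia.
  have jn := ltn_ord j.
  rewrite !inordK; try lia.
  transitivity (gl z mrg (n + m).+1 k.+1 (j + m)
    (gl z mrg n.+1 m.+1 i (label (val p)) (label (val q))) (label (val r)) x y).
    by apply: gl_ext => //= [|x' y' h|]; [lia|rewrite label_compose //|]; lia.
  transitivity (gl z mrg (n + k).+1 m.+1 i
    (gl z mrg n.+1 k.+1 j (label (val p)) (label (val r))) (label (val q)) x y); last first.
    by apply: gl_ext => //= [|x' y' h|]; [lia|rewrite label_compose //|]; lia.
  have := @gl_par _ z mrg mrg1l mrg1r mrgE n.+1 m.+1 k.+1 i j (label (val p))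
    (label (val q)) (label (val r)) x y.
  rewrite !addnS !addSn /=; apply => //; try exact: label1; lia.
Defined.

End Polygon.

Inductive bnc_magma := Mone | Ma | Mb.
Definition bnc_magma_code x : option bool :=
  match x with Mone => None | Ma => Some true | Mb => Some false end.
Definition bnc_magma_decode x : bnc_magma :=
  match x with None => Mone | Some true => Ma | Some false => Mb end.
Lemma bnc_magma_codeK : cancel bnc_magma_code bnc_magma_decode. Proof. by case. Qed.
HB.instance Definition _ := Finite.copy bnc_magma (can_type bnc_magma_codeK).

(* Unit Mone; this product is not associative. *)
Definition bnc_star (x y : bnc_magma) : bnc_magma :=
  match x, y with
  | Mone, _ => y
  | _, Mone => x
  | Ma, Ma => Ma
  | Mb, Mb => Mb
  | _, _ => Mone
  end.

(* Noncrossing cliques of arity n over bnc_magma; the first condition says that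
   the one of arity 1 is unique. *)
Definition noncrossing_clique n (p : polygon bnc_magma n) : bool :=
  ((n == 1) ==> (label Mone p 0 1 == Mone)) &&
  [forall a : arc n, forall b : arc n,
    [&& diagonal n (src a) (tgt a), diagonal n (src b) (tgt b),
        p a != Mone & p b != Mone] ==>
    ~~ crossing (src a) (tgt a) (src b) (tgt b)].

Inductive color := Uncolored | Blue | Red.
Definition color_code x : option bool :=
  match x with Uncolored => None | Blue => Some true | Red => Some false end.
Definition color_decode x : color :=
  match x with None => Uncolored | Some true => Blue | Some false => Red end.
Lemma color_codeK : cancel color_code color_decode. Proof. by case. Qed.
HB.instance Definition _ := Finite.copy color (can_type color_codeK).

(* No restriction to diagonals is needed in the crossing condition: crossing arcs
   are diagonals. *)
Definition bnc_configuration n (c : polygon color n) : bool :=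
  [&& (n == 1) ==> (label Uncolored c 0 1 == Uncolored),
      [forall a : arc n, forall b : arc n,
        (c a != Uncolored) && (c b != Uncolored) ==>
        ~~ crossing (src a) (tgt a) (src b) (tgt b)]
    & [forall a : arc n, (c a == Red) ==> diagonal n (src a) (tgt a)]].

(* The rule of the last case is the composition of configurations of arities at
   least 2.  When one of the arities is 1, that configuration is the unit, and
   keeping the label of the other one yields the unit laws. *)
Definition color_merge (n m : nat) (v w : color) : color :=
  if n == 1 then w else if m == 1 then v else
  match v, w with
  | Uncolored, Uncolored => Red
  | Blue, Blue => Blue
  | _, _ => Uncolored
  end.

Lemma clique_ncrP n (p : polygon bnc_magma n) :
  reflect ((n = 1 -> label Mone p 0 1 = Mone) /\ ncr Mone n (label Mone p))
          (noncrossing_clique p).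
Proof.
apply: (iffP andP) => [[/implyP p1 /'forall_forallP nc]|[p1 nc]]; split.
- by move=> /eqP/p1/eqP.
- move=> x y x' y' h h'.
  have /arc_exists[a [ex ey]] : x < y <= n by lia.
  have /arc_exists[b [ex' ey']] : x' < y' <= n by lia.
  rewrite -ex -ey -ex' -ey' !label_arc => pa pb.
  have /implyP/(_ _)/negP[] := nc a b.
    by rewrite pa pb /diagonal !xpair_eqE; lia.
  by rewrite /crossing; lia.
- by apply/implyP=> /eqP/p1/eqP.
- apply/'forall_forallP => a b; apply/implyP=> /and4P[_ _ pa pb].
  move: pa pb; rewrite -!(label_arc Mone) => pa pb.
  have [ha hb] := (arc_bound a, arc_bound b).
  apply/negP=> /orP[] h.
    by apply: (nc (src a) (tgt a) (src b) (tgt b)) => //; lia.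
  by apply: (nc (src b) (tgt b) (src a) (tgt a)) => //; lia.
Qed.

Lemma bnc_configurationP n (c : polygon color n) :
  reflect [/\ n = 1 -> label Uncolored c 0 1 = Uncolored,
              ncr Uncolored n (label Uncolored c)
            & dgr Red n (label Uncolored c)]
          (bnc_configuration c).
Proof.
apply: (iffP and3P) => [[/implyP c1 /'forall_forallP nc /forallP rd]|[c1 nc rd]]; split.
- by move=> /eqP/c1/eqP.
- move=> x y x' y' h h'.
  have /arc_exists[a [ex ey]] : x < y <= n by lia.
  have /arc_exists[b [ex' ey']] : x' < y' <= n by lia.
  rewrite -ex -ey -ex' -ey' !label_arc => ca cb.
  have /implyP/(_ _)/negP[] := nc a b; first by rewrite ca cb.
  by rewrite /crossing; lia.
- move=> x y /arc_exists[a [<- <-]]; rewrite label_arc => /eqP ca.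
  exact: (implyP (rd a)).
- by apply/implyP=> /eqP/c1/eqP.
- apply/'forall_forallP => a b; apply/implyP=> /andP[].
  rewrite -!(label_arc Uncolored) => ca cb.
  have [ha hb] := (arc_bound a, arc_bound b).
  apply/negP=> /orP[] h.
    by apply: (nc (src a) (tgt a) (src b) (tgt b)) => //; lia.
  by apply: (nc (src b) (tgt b) (src a) (tgt a)) => //; lia.
- apply/forallP=> a; apply/implyP=> /eqP; rewrite -(label_arc Uncolored).
  by apply: rd; apply: arc_bound.
Qed.

Lemma ncr_ext (L : eqType) (z : L) n (p p' : nat -> nat -> L) :
  (forall x y, x < y <= n -> p x y = p' x y) -> ncr z n p -> ncr z n p'.
Proof. by move=> pp np x y x' y' h h'; rewrite -!pp; [exact: np | lia..]. Qed.

Lemma bnc_star1l m v : 0 < m -> bnc_star Mone v = v. Proof. by []. Qed.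
Lemma bnc_star1r n v : 0 < n -> (n = 1 -> v = Mone) -> bnc_star v Mone = v.
Proof. by case: v. Qed.

Lemma color_merge1l m v : 0 < m -> color_merge 1 m Uncolored v = v.
Proof. by []. Qed.
Lemma color_merge1r n v : 0 < n -> (n = 1 -> v = Uncolored) ->
  color_merge n 1 v Uncolored = v.
Proof. by rewrite /color_merge; case: eqP => // n1 _ ->. Qed.

Lemma color_mergeE n n' m m' :
  1 < n -> 1 < n' -> 1 < m -> 1 < m' -> color_merge n m = color_merge n' m'.
Proof.
by case: n => [|[|n]] // _; case: n' => [|[|n']] // _;
  case: m => [|[|m]] // _; case: m' => [|[|m']].
Qed.

Lemma color_merge_red n m v w : 0 < n -> 0 < m -> color_merge n m v w = Red ->
  [\/ n = 1 /\ w = Red, m = 1 /\ v = Red | 1 < n /\ 1 < m].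
Proof.
case: n => [|[|n]] // _; case: m => [|[|m]] // _; rewrite /color_merge /= => h.
- exact: Or31.
- exact: Or31.
- exact: Or32.
- exact: Or33.
Qed.

Lemma blank_clique : noncrossing_clique (blank Mone 1).
Proof.
by apply/clique_ncrP; split=> [_|x y x' y' _ _]; rewrite label_blank ?eqxx.
Qed.

Lemma compose_clique n m (i : 'I_n.+1) (p : polygon bnc_magma n.+1)
    (q : polygon bnc_magma m.+1) :
  noncrossing_clique p -> noncrossing_clique q ->
  noncrossing_clique (compose Mone (fun _ _ => bnc_star) i p q).
Proof.
move=> /clique_ncrP[p1 np] /clique_ncrP[q1 nq]; apply/clique_ncrP; split.
  move=> nm1; have [n0 m0] : n = 0 /\ m = 0 by lia.
  subst n m; rewrite label_compose // /gl ord1 p1 // q1 //.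
apply: (@ncr_ext _ _ _
  (gl Mone (fun _ _ => bnc_star) n.+1 m.+1 i (label Mone p) (label Mone q))).
  by move=> x y xy; rewrite label_compose.
by rewrite -[(n + m).+1]/(n.+1 + m).+1.-1 -addnS; apply: gl_ncr.
Qed.

Lemma clique1 (p : polygon bnc_magma 1) :
  noncrossing_clique p -> label Mone p 0 1 = Mone.
Proof. by case/clique_ncrP=> + _; apply. Qed.

Definition NC_set : set_operad :=
  @polygon_operad bnc_magma Mone (fun _ _ => bnc_star)
    bnc_star1l bnc_star1r (fun _ _ _ _ _ _ _ _ => erefl)
    noncrossing_clique clique1 blank_clique compose_clique.

Lemma blank_configuration : bnc_configuration (blank Uncolored 1).
Proof.
by apply/bnc_configurationP; split=> [_|x y x' y' _ _|x y _]; rewrite label_blank ?eqxx.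
Qed.

Lemma compose_configuration n m (i : 'I_n.+1) (c : polygon color n.+1)
    (d : polygon color m.+1) :
  bnc_configuration c -> bnc_configuration d ->
  bnc_configuration (compose Uncolored color_merge i c d).
Proof.
move=> /bnc_configurationP[c1 nc rc] /bnc_configurationP[d1 nd rd].
apply/bnc_configurationP; split.
- move=> nm1; have [n0 m0] : n = 0 /\ m = 0 by lia.
  by subst n m; rewrite label_compose // /gl ord1 c1 // d1.
- apply: (@ncr_ext _ _ _
    (gl Uncolored color_merge n.+1 m.+1 i (label Uncolored c) (label Uncolored d))).
    by move=> x y xy; rewrite label_compose.
  by rewrite -[(n + m).+1]/(n.+1 + m).+1.-1 -addnS; apply: gl_ncr.
- move=> x y xy; rewrite label_compose //.
  move: xy; rewrite -[(n + m).+1]/(n.+1 + m).+1.-1 -addnS.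
  exact: (gl_dgr color_merge_red).
Qed.

Lemma configuration1 (c : polygon color 1) :
  bnc_configuration c -> label Uncolored c 0 1 = Uncolored.
Proof. by case/bnc_configurationP=> + _ _; apply. Qed.

Definition BNC_set : set_operad :=
  @polygon_operad color Uncolored color_merge
    color_merge1l color_merge1r color_mergeE bnc_configuration
    configuration1 blank_configuration compose_configuration.

(* The label depends on whether the arc is a diagonal; edges and bases are never
   red. *)
Definition phi_label (diag : bool) (c : color) : bnc_magma :=
  match c with
  | Blue => Ma
  | Red => Mb
  | Uncolored => if diag then Mone else Mb
  end.

Definition phi_polygon n (c : polygon color n) : polygon bnc_magma n :=
  if n == 1 then blank Mone n
  else [ffun a => phi_label (diagonal n (src a) (tgt a)) (c a)].

Lemma phi_polygon_clique n (c : polygon color n) :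
  bnc_configuration c -> noncrossing_clique (phi_polygon c).
Proof.
case/and3P=> _ /'forall_forallP nc _; rewrite /phi_polygon.
case: eqVneq => [n1|n1]; apply/andP; split.
- by apply/implyP=> _; rewrite label_blank.
- by apply/'forall_forallP => a b; rewrite !ffunE eqxx /= !andbF.
- by rewrite (negPf n1).
apply/'forall_forallP => a b; apply/implyP; rewrite !ffunE.
move=> /and4P[da db ca cb]; apply: (implyP (nc a b)); apply/andP; split.
  by move: ca; rewrite da; case: (c a).
by move: cb; rewrite db; case: (c b).
Qed.

Definition phi_set n (c : BNC_set n) : NC_set n :=
  Sub (phi_polygon (val c)) (phi_polygon_clique (valP c)).

(* No edge and no base is labeled by the unit. *)
Definition solid_border n (p : polygon bnc_magma n) : bool :=
  (label Mone p 0 n != Mone) && [forall i : 'I_n, label Mone p i i.+1 != Mone].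

Section Operads.
Variable K : fieldType.

Definition NCM : operad K := linearization K NC_set.
Definition BNC : operad K := linearization K BNC_set.

Definition phi n : BNC n -> NCM n := free_map (@phi_set n).

(* Component of arity n.+1; in arity 1 the unique clique is included, although its
   label is the unit. *)
Definition solid_border_span n : {vspace freemod K (NC_set n)} :=
  <<[seq basis_elt K x | x <- enum (NC_set n) & (n == 0)%N || solid_border (val x)]>>%VS.
End Operads.

(* Main.v *)
From HB Require Import structures.
Require Import Defs.
From mathcomp Require Import all_boot all_order all_algebra.
From mathcomp Require Import zify.
Import GRing.Theory.
Local Open Scope ring_scope.

Set Implicit Arguments. Unset Strict Implicit. Unset Printing Implicit Defensive.

(** Both operads have a basis stable under partial composition, and [phi] sends
basis elements to basis elements, so everything reduces to the map [phi_set]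
between configurations and cliques.

Bijectivity on bases: a color is turned into a label in two ways, according to
whether the arc is a diagonal. On diagonals, uncolored, blue and red become 1, a
and b, which is a bijection with the whole magma. On edges and on the base, where
red is excluded, uncolored and blue become b and a, which are exactly the labels
different from 1. Hence the cliques hit are those with a solid border (together
with the one of arity 1). Reading the labels backwards gives [psi_set], a map
defined on every clique, which is a left inverse of [phi_set] and, on the cliques
with a solid border, a right inverse ([phi_setK], [psi_setK]).

Compatibility with composition: gluing d onto an edge of c keeps the diagonals of
both as diagonals, keeps the other edges and the base of c on the border, and
turns the glued edge and base into one new diagonal. There the rule of colors
must be the product of the magma: uncolored and uncolored give red, as b * b = b;
blue and blue give blue, as a * a = a; the mixed case gives uncolored, as
a * b = b * a = 1 ([phi_merge]). The remaining new arcs are uncolored diagonals,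
labeled by 1. When one of the arities is 1, the claim is a unit law
([phi_set_comp]).

By linearity [phi] is an injective operad morphism whose image is the span of the
cliques with a solid border. So this span, being an image, is closed under
composition, and [phi] is an isomorphism onto it, with inverse the restriction of
the linear extension of [psi_set]. *)

(** * Linear extension of maps between bases *)

Lemma eq_on_span (K : fieldType) (V W : vectType K) (f g : V -> W) (X : seq V) :
  linear f -> linear g -> {in X, f =1 g} -> {in <<X>>%VS, f =1 g}.
Proof.
move=> lf lg fg x xX.
pose F := HB.pack_for {linear V -> W} f (GRing.isLinear.Build K _ _ _ f lf).
pose G := HB.pack_for {linear V -> W} g (GRing.isLinear.Build K _ _ _ g lg).
rewrite -[f]/(F : V -> W) -[g]/(G : V -> W) (coord_span (X := in_tuple X) xX) !linear_sum.
by apply: eq_bigr => i _; rewrite !linearZ; congr (_ *: _); apply/fg/mem_nth.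
Qed.

Section FreeMap.
Variable K : fieldType.

Lemma free_map_linear (T U : finType) (h : T -> U) : linear (@free_map K T U h).
Proof.
move=> a f g; rewrite /free_map scaler_sumr -big_split; apply: eq_bigr => t _ /=.
by rewrite !ffunE scalerDl scalerA.
Qed.

Lemma free_map_basis (T U : finType) (h : T -> U) t :
  free_map h (basis_elt K t) = basis_elt K (h t).
Proof.
rewrite /free_map (bigD1 t) //= ffunE eqxx scale1r big1 ?addr0 // => u ut.
by rewrite ffunE (negPf ut) scale0r.
Qed.

Lemma free_mapK (T U : finType) (h : T -> U) (k : U -> T) :
  cancel h k -> cancel (@free_map K T U h) (free_map k).
Proof.
move=> hK; apply: (@free_ext K T (freemod K T)) => [||t].
- exact: (linear_comp (free_map_linear h) (free_map_linear k)).
- by [].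
- by rewrite !free_map_basis hK.
Qed.

(** Linearization is functorial: a morphism of set operads extends to a morphism of
operads. Both sides are bilinear, so basis elements suffice. *)
Lemma free_map_comp (P Q : set_operad) (h : forall n, P n -> Q n) n m (i : 'I_n.+1) :
  (forall x y, h (n + m)%N (set_comp i x y) = set_comp i (h n x) (h m y)) ->
  forall (x : freemod K (P n)) (y : freemod K (P m)),
  free_map (h _) (lin_comp i x y) = lin_comp i (free_map (h n) x) (free_map (h m) y).
Proof.
move=> hM x y; move: x.
apply: (@free_ext K _ (freemod K (Q (n + m)%N))) => [||x].
- exact: (linear_comp (lin_compl i y) (free_map_linear _)).
- exact: (linear_comp (free_map_linear _) (lin_compl i (free_map (h m) y))).
move: y; apply: (@free_ext K _ (freemod K (Q (n + m)%N))) => [||y].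
- exact: (linear_comp (lin_compr i (basis_elt K x)) (free_map_linear _)).
- exact: (linear_comp (free_map_linear _) (lin_compr i _)).
by rewrite lin_comp_basis !free_map_basis lin_comp_basis hM.
Qed.

End FreeMap.

Lemma is_operad_iso_inv (K : fieldType) (P Q : operad K)
    (f : forall n, P n -> Q n) (g : forall n, Q n -> P n) :
  (forall n, cancel (f n) (g n)) -> (forall n, cancel (g n) (f n)) ->
  is_operad_iso f -> is_operad_iso g.
Proof.
move=> fK gK [lf _ f1 fM]; split.
- by move=> n a x y; apply: (can_inj (fK n)); rewrite lf !gK.
- by move=> n; exists (f n).
- by rewrite -f1 fK.
- by move=> n m i x y; apply: (can_inj (fK _)); rewrite fM !gK.
Qed.

Local Open Scope nat_scope.

(** * The bijection between configurations and cliques with a solid border *)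

(** Off the diagonals the value at the unit is a filler: [phi_label] never takes it
there. Choosing uncolored, rather than restricting to solid borders, makes
[psi_set] total, so that it extends linearly to the whole clique operad. *)
Definition psi_label (diag : bool) (l : bnc_magma) : color :=
  match l with
  | Ma => Blue
  | Mb => if diag then Red else Uncolored
  | Mone => Uncolored
  end.

Definition psi_polygon n (p : polygon bnc_magma n) : polygon color n :=
  [ffun a => psi_label (diagonal n (src a) (tgt a)) (p a)].

Lemma psi_polygon_configuration n (p : polygon bnc_magma n) :
  noncrossing_clique p -> bnc_configuration (psi_polygon p).
Proof.
move=> p_nc; have /andP[p1 /'forall_forallP nc] := p_nc; apply/and3P; split.
- apply/implyP=> /eqP n1; subst n.
  have /arc_exists[a [a0 a1]] : 0 < 1 <= 1 by [].
  have := label_arc Uncolored (psi_polygon p) a.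
  by rewrite ffunE -(label_arc Mone) a0 a1 clique1 // => ->.
- apply/'forall_forallP => a b; apply/implyP; rewrite !ffunE => /andP[pa pb].
  apply/negP=> ab; have := nc a b; rewrite ab implybF => /negP; apply.
  have [ha hb] := (arc_bound a, arc_bound b).
  (* The clique condition speaks of diagonals only, the configuration condition of
     all arcs; they agree since two arcs that cross are diagonals. *)
  apply/and4P; split; try by [case: (p a) pa | case: (p b) pb].
    by rewrite /diagonal !xpair_eqE; move: ab; rewrite /crossing; lia.
  by rewrite /diagonal !xpair_eqE; move: ab; rewrite /crossing; lia.
- by apply/forallP=> a; rewrite ffunE; case: (p a); case: diagonal.
Qed.

Definition psi_set n (p : NC_set n) : BNC_set n :=
  Sub (psi_polygon (val p)) (psi_polygon_configuration (valP p)).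

Lemma BNC_arity1 (c : BNC_set 0) : c = set_unit BNC_set.
Proof.
apply/val_inj/(polygonP Uncolored) => x y xy.
have -> : x = 0 by lia. have -> : y = 1 by lia.
by rewrite label_blank configuration1 ?(valP c).
Qed.

Lemma NC_arity1 (p : NC_set 0) : p = set_unit NC_set.
Proof.
apply/val_inj/(polygonP Mone) => x y xy.
have -> : x = 0 by lia. have -> : y = 1 by lia.
by rewrite label_blank clique1 ?(valP p).
Qed.

(** On the border [psi_label] sends both b and 1 to uncolored, which [phi_label]
sends back to b; hence the restriction to cliques that avoid 1 there. *)
Lemma psi_setK n (p : NC_set n) :
  (n == 0) || solid_border (val p) -> phi_set (psi_set p) = p.
Proof.
case: n p => [|n] p; first by rewrite [LHS]NC_arity1 [RHS]NC_arity1.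
move=> /= /andP[p0 /forallP pi]; apply/val_inj/ffunP => a /=.
rewrite !ffunE.
have [ha] := arc_bound a.
case: (boolP (diagonal _ _ _)) => [|nd]; first by case: (val p a).
suff: val p a != Mone by case: (val p a).
rewrite -(label_arc Mone); move: nd; rewrite /diagonal negb_and !negbK.
case/orP=> [/eqP ->|/eqP[-> ->]] //.
have hi : src a < n.+2 by lia.
exact: (pi (Ordinal hi)).
Qed.

(** Injectivity holds because red is excluded from the border, where red and
uncolored would both be labeled by b. *)
Lemma phi_setK n : cancel (@phi_set n) (@psi_set n).
Proof.
case: n => [|n] c; first by rewrite [LHS]BNC_arity1 [RHS]BNC_arity1.
apply/val_inj/ffunP => a; rewrite /= !ffunE.
have /and3P[_ _ /forallP/(_ a)/implyP] := valP c.
by case: (val c a); case: diagonal => //= /(_ isT).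
Qed.

Lemma phi_set_solid n (c : BNC_set n) : (n == 0) || solid_border (val (phi_set c)).
Proof.
case: n c => [|n] c //=.
have solid x y : x < y <= n.+2 -> ~~ diagonal n.+2 x y ->
    label Mone (phi_polygon (val c)) x y != Mone.
  case/arc_exists=> a [<- <-]; rewrite label_arc ffunE => /negPf ->.
  by case: (val c a).
apply/andP; split; first by apply: solid; rewrite ?leqnn // /diagonal eqxx andbF.
by apply/forallP => i; apply: solid; rewrite ?ltnSn ?ltn_ord // /diagonal eqxx.
Qed.

(** * Compatibility with the partial compositions *)

Definition phi_labeling n (c : nat -> nat -> color) x y : bnc_magma :=
  phi_label (diagonal n x y) (c x y).

(** The table of the magma encodes the gluing rule: the two glued arcs lie on the
borders of their polygons, while the result is a diagonal. The arities 2 stand for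
any arities at least 2, on which [color_merge] does not depend. *)
Lemma phi_merge v w : v <> Red -> w <> Red ->
  phi_label true (color_merge 2 2 v w) = bnc_star (phi_label false v) (phi_label false w).
Proof. by case: v; case: w. Qed.

(** Gluing sends diagonals to diagonals and the other border arcs to border arcs, so
the labels carried over from c and d are read in the same mode before and after;
only the glued arc changes mode, and is handled by [phi_merge]. *)
Lemma phi_gl n m i c d x y :
  1 < n -> 1 < m -> i < n -> dgr Red n c -> dgr Red m d -> x < y <= (n + m).-1 ->
  phi_labeling (n + m).-1 (gl Uncolored color_merge n m i c d) x y =
  gl Mone (fun _ _ => bnc_star) n m i (phi_labeling n c) (phi_labeling m d) x y.
Proof.
move=> n2 m2 ltin rc rd xy; rewrite /phi_labeling /gl.
have -> : diagonal n i i.+1 = false by rewrite /diagonal eqxx.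
have -> : diagonal m 0 m = false by rewrite /diagonal eqxx andbF.
rewrite -phi_merge; last first.
- by move/rd; rewrite /diagonal eqxx andbF => h; suff: false by []; apply: h; lia.
- by move/rc; rewrite /diagonal eqxx => h; suff: false by []; apply: h; lia.
rewrite (color_mergeE (n' := 2) (m' := 2)) // /glue !xpair_eqE.
repeat case: ifP => ?; try (congr phi_label; rewrite /diagonal !xpair_eqE; lia).
(* Left: the new arcs, uncolored diagonals of the glued polygon. *)
have -> : diagonal (n + m).-1 x y by rewrite /diagonal !xpair_eqE; lia.
by [].
Qed.

Lemma label_phi_polygon n (c : polygon color n) x y :
  1 < n -> x < y <= n ->
  label Mone (phi_polygon c) x y = phi_labeling n (label Uncolored c) x y.
Proof.
move=> n2 /arc_exists[a [<- <-]]; rewrite /phi_labeling !label_arc /phi_polygon.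
by rewrite gtn_eqF // ffunE.
Qed.

(** If one of the arities is 1, its polygon is the unit of the operad, and both sides
reduce to the other polygon by the unit laws. *)
Lemma phi_set_comp n m (i : 'I_n.+1) (c : BNC_set n) (d : BNC_set m) :
  phi_set (set_comp i c d) = set_comp i (phi_set c) (phi_set d).
Proof.
case: n i c => [|n] i c.
  by rewrite (ord1 i) (BNC_arity1 c) (NC_arity1 (phi_set _)) !set_unitl.
case: m d => [|m] d.
  have phi_cast k l (e : k = l) (x : BNC_set k) :
      phi_set (cast_ar (T := set_car BNC_set) e x) = cast_ar (T := set_car NC_set) e (phi_set x).
    by case: l / e.
  have cast_inj k l (e : k = l) : injective (@cast_ar (set_car NC_set) k l e) by case: l / e.
  apply: (@cast_inj _ _ (addn0 n.+1)).
  by rewrite (BNC_arity1 d) -phi_cast (NC_arity1 (phi_set _)) !set_unitr.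
apply/val_inj/(polygonP Mone) => x y xy.
rewrite label_phi_polygon //= label_compose //.
have [_ _ rc] := bnc_configurationP _ (valP c).
have [_ _ rd] := bnc_configurationP _ (valP d).
rewrite /phi_labeling label_compose // -/(phi_labeling _ _ x y).
transitivity (gl Mone (fun _ _ => bnc_star) n.+2 m.+2 i
  (phi_labeling n.+2 (label Uncolored (val c)))
  (phi_labeling m.+2 (label Uncolored (val d))) x y).
  by rewrite -phi_gl // (addnS n.+2).
apply: (gl_ext _ blank_clique) => // [x' y' h|x' y' h|]; rewrite ?label_phi_polygon //; lia.
Qed.

Local Open Scope ring_scope.

(** * The isomorphism onto the span *)

Section Isomorphism.
Variable K : fieldType.

Definition psi n : NCM K n -> BNC K n := free_map (@psi_set n).

Lemma phi_comp n m (i : 'I_n.+1) (c : BNC K n) (d : BNC K m) :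
  phi (op_comp i c d) = op_comp i (phi c) (phi d).
Proof. exact: (free_map_comp (h := phi_set) (@phi_set_comp n m i)). Qed.

Lemma phi_unit : phi (op_unit (BNC K)) = op_unit (NCM K).
Proof. by rewrite [LHS]free_map_basis [phi_set _]NC_arity1. Qed.

Lemma phiK n : cancel (@phi K n) (@psi n).
Proof. exact/free_mapK/phi_setK. Qed.

Lemma psiK n (x : NCM K n) : x \in solid_border_span K n -> phi (psi x) = x.
Proof.
move: x; apply: (@eq_on_span _ (freemod K (NC_set n)) (freemod K (NC_set n))).
- exact: (linear_comp (free_map_linear _) (free_map_linear _)).
- by [].
- move=> y /mapP[x]; rewrite mem_filter => /andP[xs _] ->.
  by rewrite /psi /phi !free_map_basis psi_setK.
Qed.

Lemma phi_in n (c : BNC K n) : phi c \in solid_border_span K n.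
Proof.
rewrite /phi /free_map; apply: memv_suml => t _; apply: memvZ.
by apply/memv_span/map_f; rewrite mem_filter mem_enum phi_set_solid.
Qed.

(** Closure under composition comes for free from the span being the image of the
morphism [phi], instead of an analysis of the borders of composed cliques. *)
Definition solid_border_suboperad : suboperad (NCM K).
Proof.
refine (@Suboperad K (NCM K) (fun n => solid_border_span K n) _ _).
- by rewrite -phi_unit phi_in.
- by move=> n m i x y /psiK <- /psiK <-; rewrite -phi_comp phi_in.
Defined.

Definition phi_corestrict n (c : BNC K n) : operad_of_suboperad solid_border_suboperad n :=
  Subspace (S := solid_border_suboperad n) (phi_in c).

Definition psi_restrict n (u : operad_of_suboperad solid_border_suboperad n) : BNC K n :=
  psi (subspace_val u).
End Isomorphism.

Lemma phi_corestrictK (K : fieldType) n : cancel (@phi_corestrict K n) (@psi_restrict K n).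
Proof. exact: phiK. Qed.

Lemma psi_restrictK (K : fieldType) n : cancel (@psi_restrict K n) (@phi_corestrict K n).
Proof. by move=> u; apply/val_inj/psiK/(valP u). Qed.

Lemma phi_corestrict_iso (K : fieldType) : is_operad_iso (@phi_corestrict K).
Proof.
split.
- by move=> n a c d; apply/val_inj/free_map_linear.
- by move=> n; exists (@psi_restrict K n); [exact: phi_corestrictK | exact: psi_restrictK].
- exact/val_inj/phi_unit.
- by move=> n m i c d; apply/val_inj/phi_comp.
Qed.

Theorem proposition5p2p1 (K : fieldType) (charK : [pchar K] =i pred0) :
  exists S : suboperad (NCM K),
    [/\ forall (n : nat) (x : NCM K n), (x \in S n) = (x \in solid_border_span K n),
        isomorphic (operad_of_suboperad S) (BNC K)
      & exists f : forall n : nat, BNC K n -> operad_of_suboperad S n,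
          is_operad_iso f /\
          forall (n : nat) (c : BNC K n), subspace_val (f n c) = phi c].
Proof.
exists (solid_border_suboperad K); split=> //.
- exists (@psi_restrict K).
  exact: (is_operad_iso_inv (@phi_corestrictK K) (@psi_restrictK K) (phi_corestrict_iso K)).
- by exists (@phi_corestrict K); split; first exact: phi_corestrict_iso.
Qed.
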